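(* $\chi_{CF}(\mathsf{I}^2_n)=\Theta(\sqrt{n})$ as $n\to\infty$.
   Context: A conflict-free coloring (CF-coloring) of a hypergraph $(V,\mathcal{E})$ is a map $\varphi$ on $V$ such that every nonempty hyperedge $e$ contains a vertex $x$ with $\varphi(y)\ne\varphi(x)$ for all $y\in e\setminus\{x\}$; $\chi_{CF}(H)$ is the least number of colors in a CF-coloring of $H$. A (discrete) interval in $[n]$ is a subset of $[n]$ consisting of consecutive integers. The 2-interval hypergraph $\mathsf{I}^2_n$ has vertex set $[n]$ and hyperedges all sets $I_1\cup I_2$ where $I_1,I_2\subseteq[n]$ are intervals and $|I_1\cup I_2|\ge 3$. *)

(* Defs.v *)
From mathcomp Require Import all_boot.

Set Implicit Arguments.
Unset Strict Implicit.
Unset Printing Implicit Defensive.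

(* A hypergraph on a finite vertex type V is given by its set of hyperedges. *)
Definition hypergraph (V : finType) := {set {set V}}.

Definition cf_coloring (V C : finType) (H : hypergraph V) (phi : V -> C) :=
  [forall e in H, (e != set0) ==>
    [exists x in e, forall y in e :\ x, phi y != phi x]].

Definition cf_colorable (V : finType) (H : hypergraph V) (k : nat) :=
  [exists phi : {ffun V -> 'I_k}, cf_coloring H phi].

Lemma cf_colorable_exists (V : finType) (H : hypergraph V) :
  exists k, cf_colorable H k.
Proof.
exists #|V|; apply/existsP; exists (finfun enum_rank).
apply/forall_inP => e _; apply/implyP => /set0Pn[x xe].
apply/exists_inP; exists x => //; apply/forall_inP => y.
by rewrite !inE !ffunE (inj_eq enum_rank_inj) => /andP[].
Qed.

Definition chi_cf (V : finType) (H : hypergraph V) : nat :=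
  ex_minn (cf_colorable_exists H).

(* The vertex set [n] = {1, ..., n} is represented by 'I_n = {0, ..., n-1}. *)
(* The empty set counts as an interval (take b < a); as I :|: I = I, this   *)
(* does not affect the hyperedges of two_interval_hypergraph.               *)
Definition is_interval (n : nat) (I : {set 'I_n}) :=
  [exists a : 'I_n, exists b : 'I_n, I == [set i : 'I_n | a <= i <= b]].

Definition two_interval_hypergraph (n : nat) : hypergraph 'I_n :=
  [set I1 :|: I2 | I1 in @is_interval n, I2 in @is_interval n
                 & 3 <= #|I1 :|: I2|].

(* Main.v *)
(* Lower bound: in a CF-coloring the ordered pairs of colors of {2i, 2i+1} are
   pairwise distinct, since two such pairs with the same colors form a
   4-element hyperedge in which each color is repeated; so n <= 4 chi^2.

   Upper bound: for n <= m^2, cut [n] into m blocks of length m separated by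
   uniquely colored points, so that only unions of two windows inside blocks
   matter. Each block is rainbow, hence a bad hyperedge consists of windows of
   two different blocks using the same set of colors, one of them with at least
   two points. Within blocks odd points use colors depending only on the
   position, while the colors of even points are shifted by 4 from block to
   block: the odd colors pin a window down up to one position on each side,
   which is incompatible with the shift of the even colors. *)
Require Import Defs.
From mathcomp Require Import all_boot zify.

(** * The block coloring and windows inside its blocks *)

Lemma shifted_windows_neq s t s' t' D : 4 <= D ->
  (s < t) || (s' < t') ->
  (forall r, odd r -> (s <= r <= t) = (s' <= r <= t')) ->
  (forall r, ~~ odd r -> s <= r <= t -> s' <= r + D <= t') ->
  (forall r, ~~ odd r -> s' <= r <= t' -> (D <= r) && (s <= r - D <= t)) ->
  False.
Proof.
move=> D4 lt_st oddE evenW evenW'.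
(* If it is [[s', t']] that has two points, let [r] be the odd and [r'] the even one among [s'] and
   [s' + 1]; then [r] and [r' - D] are distinct points of [[s, t]]. *)
have {evenW' lt_st} st : s < t.
  case/orP: lt_st => // st'.
  have [os'|es'] := boolP (odd s').
    have := oddE s' os'; have := evenW' s'.+1; rewrite /= os' => /(_ isT); lia.
  have := oddE s'.+1; rewrite /= es' => /(_ isT).
  have := evenW' s' es'; lia.
(* If [e] is the largest even element of [s, t], then [s', t'] contains [e + D],
   hence the odd number [e + 3], so that [e + 2] is again in [s, t]. *)
have [ot|et] := boolP (odd t); last first.
  have := evenW t et; have := oddE t.-1; have := oddE t.+3.
  have -> : odd t.-1 by lia.
  have -> : odd t.+3 by lia.
  by move=> /(_ isT) + /(_ isT); lia.
have := evenW t.-1; have := oddE t ot; have := oddE t.+2.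
have -> : odd t.+2 by lia.
have -> : ~~ odd t.-1 by lia.
by move=> /(_ isT) + + /(_ isT); lia.
Qed.

(* The multiples of [m] are the separators; the ranges [0, m), [m, 2m), [2m, 7m)
   keep the colors of separators, odd residues and even residues apart. *)
Definition block_color m x :=
  let q := x %/ m in let r := x %% m in
  if r == 0 then q else if odd r then m + r else 2 * m + r + 4 * q.

Lemma block_colorE m q r : r < m ->
  block_color m (q * m + r) =
    if r == 0 then q else if odd r then m + r else 2 * m + r + 4 * q.
Proof.
move=> rm; rewrite /block_color modnMDl divnMDl ?(leq_ltn_trans _ rm) //.
by rewrite modn_small // divn_small // addn0.
Qed.

Lemma block_color_lt m x : x < m ^ 2 -> block_color m x < 7 * m.
Proof.
have [->|m0] := posnP m; first by rewrite exp0n.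
rewrite /block_color -mulnn => xm.
have := ltn_pmod x m0; have : x %/ m < m by rewrite ltn_divLR.
by case: ifP => _; [|case: ifP => _]; lia.
Qed.

(** The three color ranges are disjoint, the color of a separator is its quotient by [m], and inside
    a block the color determines the residue. *)
Lemma block_color_inj m x y : x < m ^ 2 -> y < m ^ 2 ->
  block_color m x = block_color m y ->
  (x %% m == 0) || (x %/ m == y %/ m) -> x = y.
Proof.
have [->|m0] := posnP m; first by rewrite exp0n.
rewrite -mulnn => xm ym.
have xq : x %/ m < m by rewrite ltn_divLR.
have yq : y %/ m < m by rewrite ltn_divLR.
rewrite /block_color => eqc eqb.
suff [eqq eqr] : x %/ m = y %/ m /\ x %% m = y %% m.
  by rewrite (divn_eq x m) (divn_eq y m) eqq eqr.
have := ltn_pmod x m0; have := ltn_pmod y m0.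
move: eqc eqb xq yq; move: (x %/ m) (y %/ m) (x %% m) (y %% m) => q q' r r'.
case: (r =P 0) => ?; case: (r' =P 0) => ?;
  case: (odd r); case: (odd r'); lia.
Qed.

(** As the color ranges are disjoint, an odd residue matches only itself, and an even residue [r] of
    block [q] matches only [r + 4 * (q - q')] in block [q']; this shift is at least 4. *)
Lemma block_color_windows_neq m q q' s t s' t' : q' < q ->
  0 < s -> t < m -> 0 < s' -> t' < m -> (s < t) || (s' < t') ->
  (forall r, s <= r <= t -> exists2 r', s' <= r' <= t' &
     block_color m (q' * m + r') = block_color m (q * m + r)) ->
  (forall r', s' <= r' <= t' -> exists2 r, s <= r <= t &
     block_color m (q * m + r) = block_color m (q' * m + r')) ->
  False.
Proof.
move=> qq s0 tm s'0 t'm lt_st W W'.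
apply: (@shifted_windows_neq s t s' t' (4 * (q - q'))) => //; first by lia.
- move=> r or; apply/idP/idP => rW.
    have [r' rW'] := W r rW; rewrite !block_colorE ?or; [|lia..].
    case: (r =P 0) => ?; case: (r' =P 0) => ?; try lia.
    by case: ifP => _ ?; [have -> : r = r' by lia | lia].
  have [r' rW'] := W' r rW; rewrite !block_colorE ?or; [|lia..].
  case: (r =P 0) => ?; case: (r' =P 0) => ?; try lia.
  by case: ifP => _ ?; [have -> : r = r' by lia | lia].
- move=> r er rW; have [r' rW'] := W r rW.
  rewrite !block_colorE ?(negbTE er); [|lia..].
  case: (r =P 0) => ?; case: (r' =P 0) => ?; try lia.
  by case: ifP => _ ?; lia.
- move=> r er rW; have [r' rW'] := W' r rW.
  rewrite !block_colorE ?(negbTE er); [|lia..].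
  case: (r =P 0) => ?; case: (r' =P 0) => ?; try lia.
  by case: ifP => _ ?; lia.
Qed.

(** If [x] lay in a later block than [a], the separator starting the block of [x] would lie in
    [[a, b]]. *)
Lemma interval_in_block m a b x : 0 < m ->
  (forall y, a <= y <= b -> y %% m != 0) -> a <= x <= b -> x %/ m = a %/ m.
Proof.
move=> m0 nsep /andP[ax xb]; apply/eqP; rewrite eqn_leq (leq_div2r m ax) andbT.
rewrite leqNgt; apply/negP => ltq.
suff /nsep : a <= x %/ m * m <= b by rewrite modnMl.
rewrite (leq_trans (leq_trunc_div x m)) // andbT.
by rewrite (divn_eq a m); have := ltn_pmod a m0; nia.
Qed.

Lemma block_color_twice_small m a b c d : b < m ^ 2 -> d < m ^ 2 ->
  (forall x, (a <= x <= b) || (c <= x <= d) ->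
     exists y, [/\ (a <= y <= b) || (c <= y <= d), y <> x &
                   block_color m y = block_color m x]) ->
  (b <= a) && (d <= c).
Proof.
move=> bm dm twice.
have m0 : 0 < m by case: m bm {dm twice}.
apply: contraT; rewrite negb_and -!ltnNge => nontriv.
have nsep x : (a <= x <= b) || (c <= x <= d) -> x %% m != 0.
  move=> xe; have [y [ye yx cyx]] := twice x xe; apply/eqP => x0.
  by apply: yx; apply/esym/(@block_color_inj m) => //; [lia|lia|rewrite x0].
have blk1 x : a <= x <= b -> x %/ m = a %/ m.
  by apply: interval_in_block => // y yI; apply: nsep; rewrite yI.
have blk2 x : c <= x <= d -> x %/ m = c %/ m.
  by apply: interval_in_block => // y yI; apply: nsep; rewrite yI orbT.
have diff x y : x < m ^ 2 -> y < m ^ 2 -> y <> x ->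
    block_color m y = block_color m x -> y %/ m <> x %/ m.
  by move=> xm ym yx cyx eqq; apply/yx/(@block_color_inj m); rewrite ?eqq ?eqxx ?orbT.
have other1 x : a <= x <= b ->
    exists2 y, c <= y <= d & block_color m y = block_color m x.
  move=> xI; have [|y [/orP[yI|yI] yx cyx]] := twice x; first by rewrite xI.
    by case: (diff x y) => //; [lia|lia|rewrite !blk1].
  by exists y.
have other2 x : c <= x <= d ->
    exists2 y, a <= y <= b & block_color m y = block_color m x.
  move=> xI; have [|y [/orP[yI|yI] yx cyx]] := twice x; first by rewrite xI orbT.
    by exists y.
  by case: (diff x y) => //; [lia|lia|rewrite !blk2].
(* The nontrivial interval is nonempty, and a point of it has a partner in the other one. *)
have [ab cd] : a <= b /\ c <= d.
  case/orP: nontriv => lt.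
    by have [|y] := other1 a; lia.
  by have [|y] := other2 c; lia.
(* Otherwise both intervals would lie in one block, where no color repeats. *)
have neq : a %/ m != c %/ m.
  have [|y yI cy] := other1 a; first by rewrite leqnn.
  have := blk2 y yI; move=> <-; apply/eqP => eqq.
  have [|z [/orP[zI|zI] za cz]] := twice a; first by rewrite leqnn ab.
    by case: (diff a z) => //; [lia|lia|rewrite (blk1 _ zI)].
  by case: (diff a z) => //; [lia|lia|rewrite (blk2 _ zI) eqq blk2].
have sep_gt0 x : (a <= x <= b) || (c <= x <= d) -> 0 < x %% m.
  by move=> xe; rewrite lt0n nsep.
(* Points are now replaced by their residues, turning the intervals into windows of the blocks [q]
   and [q']. *)
pose q := a %/ m; pose q' := c %/ m.
have bq : b = q * m + b %% m by rewrite {1}(divn_eq b m) blk1 ?ab ?leqnn.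
have dq : d = q' * m + d %% m by rewrite {1}(divn_eq d m) blk2 ?cd ?leqnn.
have E1 r : (a %% m <= r <= b %% m) = (a <= q * m + r <= b).
  by rewrite [in RHS]bq {2}(divn_eq a m) !leq_add2l.
have E2 r : (c %% m <= r <= d %% m) = (c <= q' * m + r <= d).
  by rewrite [in RHS]dq {2}(divn_eq c m) !leq_add2l.
have W r : a %% m <= r <= b %% m -> exists2 r', c %% m <= r' <= d %% m &
    block_color m (q' * m + r') = block_color m (q * m + r).
  rewrite E1 => /other1[y yI <-]; exists (y %% m); rewrite ?E2.
    by rewrite /q' -(blk2 y yI) -divn_eq.
  by rewrite /q' -(blk2 y yI) -divn_eq.
have W' r : c %% m <= r <= d %% m -> exists2 r', a %% m <= r' <= b %% m &
    block_color m (q * m + r') = block_color m (q' * m + r).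
  rewrite E2 => /other2[y yI <-]; exists (y %% m); rewrite ?E1.
    by rewrite /q -(blk1 y yI) -divn_eq.
  by rewrite /q -(blk1 y yI) -divn_eq.
have lt1 : (a %% m < b %% m) = (a < b).
  by rewrite [in RHS]bq {2}(divn_eq a m) ltn_add2l.
have lt2 : (c %% m < d %% m) = (c < d).
  by rewrite [in RHS]dq {2}(divn_eq c m) ltn_add2l.
(* The window in the block of larger index is taken as the first one. *)
case: (ltngtP q q') => [qq|qq|]; last by move/eqP; rewrite (negbTE neq).
  exfalso; apply: (block_color_windows_neq _ _ _ _ _ _ _ qq _ _ _ _ _ W' W);
    rewrite ?sep_gt0 ?ltn_pmod ?leqnn ?cd ?ab ?orbT //.
  by rewrite lt1 lt2 orbC.
exfalso; apply: (block_color_windows_neq _ _ _ _ _ _ _ qq _ _ _ _ _ W W');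
  rewrite ?sep_gt0 ?ltn_pmod ?leqnn ?cd ?ab ?orbT //.
by rewrite lt1 lt2.
Qed.

(** * Hyperedges by endpoints, and the lower bound *)

Lemma two_interval_edgeP n (e : {set 'I_n}) :
  reflect (exists a b c d : 'I_n,
             (forall x : 'I_n, (x \in e) = (a <= x <= b) || (c <= x <= d)) /\
             2 < #|e|)
          (e \in two_interval_hypergraph n).
Proof.
apply: (iffP imset2P) => [[I1 I2]|[a [b [c [d [eP e3]]]]]].
  move=> /existsP[a /existsP[b /eqP ->]].
  rewrite inE => /andP[/existsP[c /existsP[d /eqP ->]] e3] ->.
  by exists a, b, c, d; split=> // x; rewrite !inE.
have eE : e = [set i : 'I_n | a <= i <= b] :|: [set i : 'I_n | c <= i <= d].
  by apply/setP => x; rewrite eP !inE.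
exists [set i : 'I_n | a <= i <= b] [set i : 'I_n | c <= i <= d] => //.
  by apply/existsP; exists a; apply/existsP; exists b.
rewrite inE -eE e3 andbT.
by apply/existsP; exists c; apply/existsP; exists d.
Qed.

Lemma cf_coloring_pair_inj n (C : finType) (phi : 'I_n -> C) (a b c d : 'I_n) :
  cf_coloring (two_interval_hypergraph n) phi ->
  b = a.+1 :> nat -> d = c.+1 :> nat -> b < c ->
  phi a = phi c -> phi b != phi d.
Proof.
move=> /forall_inP cf ba dc bc ac; apply/eqP => bd.
pose e := [set a; b; c; d].
have eE : e \in two_interval_hypergraph n.
  apply/two_interval_edgeP; exists a, b, c, d; split=> [x|].
    by rewrite !inE -!val_eqE /=; lia.
  apply: leq_trans (subset_leq_card (_ : [set a; b; c] \subset e)); last first.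
    exact: subsetUl.
  by rewrite setUC cardsU1 cards2 !inE -!val_eqE /=; lia.
have /implyP := cf e eE.
have -> : e != set0 by apply/set0Pn; exists a; rewrite !inE eqxx.
move=> /(_ isT) /exists_inP[x xe /forall_inP ux].
have no y : y \in e -> val y != val x -> phi y = phi x -> False.
  move=> ye yx yxE; have /negP[] : phi y != phi x.
    by apply: ux; rewrite !inE in ye *; rewrite -val_eqE yx.
  exact/eqP.
(* Each vertex has its color repeated at the same position of the other pair. *)
move: xe; rewrite !inE -!orbA => /or4P[] /eqP xE; move: no; rewrite xE => no.
- by apply: (no c); rewrite ?ac //= ?inE ?eqxx ?orbT //; lia.
- by apply: (no d); rewrite ?bd //= ?inE ?eqxx ?orbT //; lia.
- by apply: (no a); rewrite ?ac //= ?inE ?eqxx ?orbT //; lia.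
- by apply: (no b); rewrite ?bd //= ?inE ?eqxx ?orbT //; lia.
Qed.

Lemma chi_cf_two_interval_lower n :
  n <= 4 * chi_cf (two_interval_hypergraph n) ^ 2.
Proof.
case: n => [//|n]; rewrite /chi_cf.
case: ex_minnP => k /existsP[phi cf] _.
have k0 : 0 < k by case: (phi ord0) => ? /(leq_ltn_trans (leq0n _)).
have lt0 (i : 'I_(n.+1./2)) : i.*2 < n.+1 by have := ltn_ord i; lia.
have lt1 (i : 'I_(n.+1./2)) : i.*2.+1 < n.+1 by have := ltn_ord i; lia.
pose f i := (phi (Ordinal (lt0 i)), phi (Ordinal (lt1 i))).
have f_inj : injective f.
  have aux (i j : 'I_(n.+1./2)) : i < j -> f i <> f j.
    move=> ij [fa fb].
    suff /negP[] : phi (Ordinal (lt1 i)) != phi (Ordinal (lt1 j)) by rewrite fb.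
    apply: (cf_coloring_pair_inj _ _ _ _ _ _ _ cf _ _ _ fa) => //=.
    by rewrite ltn_Sdouble.
  move=> i j fij; apply: val_inj => /=.
  by case: (ltngtP i j) => // /aux; rewrite fij.
have := leq_card f f_inj; rewrite card_prod !card_ord => le_k2.
(* Half the number of vertices, rounded down, is at most [k ^ 2]; [k > 0] absorbs a possible
   unpaired vertex. *)
by move: (muln_gt0 k k); rewrite k0 /= expnS expn1; lia.
Qed.

(** * The upper bound *)

Lemma cf_colorable_two_interval n m :
  n <= m ^ 2 -> cf_colorable (two_interval_hypergraph n) (7 * m).
Proof.
move=> nm2.
have xm2 (x : 'I_n) : x < m ^ 2 by apply: leq_trans nm2.
pose phi := [ffun x : 'I_n => Ordinal (block_color_lt m x (xm2 x))].
apply/existsP; exists phi; apply/forall_inP => e.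
case/two_interval_edgeP => a [b [c [d [eP e3]]]]; apply/implyP => _.
apply: contraT => /exists_inPn nouniq.
have small : (b <= a) && (d <= c).
  apply: (block_color_twice_small m) => // x xe.
  have xn : x < n.
    by have := ltn_ord b; have := ltn_ord d; case/orP: xe; lia.
  have := nouniq (Ordinal xn); rewrite eP /= => /(_ xe) /forall_inPn[y].
  rewrite !inE eP negbK => /andP[yx ye] /eqP; rewrite !ffunE => -[cyx].
  by exists y; split=> //; apply/eqP.
(* Each interval has at most one point, against [#|e| >= 3]. *)
suff /subset_leq_card : e \subset [set a; c].
  by rewrite cards2; case: (a != c); lia.
by apply/subsetP => x; rewrite eP !inE -!val_eqE /=; lia.
Qed.

(** Take [m] least: if [m >= 2], then [m ^ 2 <= 4 * (m - 1) ^ 2 < 4 * n]. *)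
Lemma square_between n : exists2 m, n <= m ^ 2 & m ^ 2 <= 4 * n.
Proof.
have ex : exists m, n <= m ^ 2 by exists n; rewrite -mulnn; nia.
case: (ex_minnP ex) => m nm2 min_m; exists m => //.
case: m nm2 min_m => [|m] nm2 min_m; first by rewrite exp0n.
have : m ^ 2 < n by rewrite ltnNge; apply/negP => /min_m; rewrite ltnn.
by move: nm2; rewrite -!mulnn; nia.
Qed.

(** The constant is [7 ^ 2 * 4], from [7 * m] colors with [m ^ 2 <= 4 * n]. *)
Lemma chi_cf_two_interval_upper n :
  chi_cf (two_interval_hypergraph n) ^ 2 <= 196 * n.
Proof.
have [m nm2 m2n] := square_between n.
rewrite /chi_cf; case: ex_minnP => k _ /(_ _ (cf_colorable_two_interval n m nm2)).
by rewrite -leq_sqr => /leq_trans; apply; rewrite expnMn; lia.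
Qed.

(* Passage to the asymptotic statement over the reals *)
From mathcomp Require Import all_boot all_order all_algebra.
From mathcomp Require Import all_classical all_reals all_analysis.
Import Order.TTheory GRing.Theory Num.Theory.
Import numFieldNormedType.Exports.
Local Open Scope classical_set_scope.
Local Open Scope ring_scope.

Theorem theorem1p7 (R : realType) :
  (fun n : nat => (chi_cf (two_interval_hypergraph n))%:R : R)
    =Theta_\oo (fun n : nat => Num.sqrt n%:R : R).
Proof.
rewrite eqThetaE qualifE; apply/asboolP.
(* The constants are the square roots of 1/4 and 196; both bounds hold for every [n]. *)
exists (2^-1, 14) => /=; first by rewrite invr_gt0 !ltr0n.
near=> n; set k := chi_cf _.
rewrite !ger0_norm ?sqrtr_ge0 ?ler0n //; split.
  rewrite ler_pdivrMl ?ltr0n //.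
  rewrite -[leRHS]ger0_norm ?mulr_ge0 ?ler0n // -sqrtr_sqr ler_wsqrtr //.
  rewrite -natrM -natrX ler_nat expnMn.
  exact: chi_cf_two_interval_lower.
rewrite -[leLHS]ger0_norm ?ler0n // -sqrtr_sqr.
rewrite -[14]ger0_norm ?ler0n // -sqrtr_sqr -sqrtrM ?sqr_ge0 // ler_wsqrtr //.
rewrite -!natrX -natrM ler_nat.
exact: chi_cf_two_interval_upper.
Unshelve. all: by end_near. Qed.
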